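(* Let $q$ be a prime power, let $X\subseteq\mathbb{F}_q$, let $t\ge2$, $n\ge1$, and let $F\in\mathbb{F}_q[x_1,\ldots,x_t]$ satisfy $$F(a,\ldots,a)=0\qquad(a\in X).$$ Let $\mathcal{R}\subseteq\Pi_t\setminus\{\widehat1\}$ be a collection of partitions such that, for every $\pi=\{B_1,\ldots,B_r\}\in\mathcal{R}$ and all $y_1,\dots,y_r\in X$, $$F_\pi(y_1,\ldots,y_r)=0\quad\Longrightarrow\quad y_1=\cdots=y_r.$$ For $\pi\in\Pi_t$ put $c_\pi=(-1)^{t-|\pi|}\prod_{B\in\pi}(|B|-1)!$, and assume that $$\beta:=(-1)^t(t-1)!-\sum_{\pi\in\mathcal{R}}c_\pi$$ is nonzero in $\mathbb{F}_q$. If $A\subseteq X^n$ contains no coordinatewise zero of $F$ formed by $t$ pairwise distinct elements, then $$|A|\le\sum_{\pi\in\Pi_t\setminus(\mathcal{R}\cup\{\widehat1\})}\operatorname{srk}\!\left(\left.\mathcal{T}_{F,\pi,n}\right|_{(X^n)^{|\pi|}}\right).$$ Likewise, if a sequence $S$ over $X^n$ contains no length-$t$ subsequence on which $F$ vanishes coordinatewise, then $$|S|\le(t-1)\sum_{\pi\in\Pi_t\setminus(\mathcal{R}\cup\{\widehat1\})}\operatorname{srk}\!\left(\left.\mathcal{T}_{F,\pi,n}\right|_{(X^n)^{|\pi|}}\right).$$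
   Context: $\Pi_t$ is the set of set partitions of $[t]=\{1,\dots,t\}$, $|\pi|$ is the number of blocks of $\pi$, and $\widehat1=\{[t]\}$ is the one-block partition. For $\pi=\{B_1,\dots,B_r\}\in\Pi_t$ (with a chosen ordering of blocks, whose choice does not affect ranks), the contraction of $F$ is $F_\pi(y_1,\dots,y_r)=F(z_1,\dots,z_t)$ with $z_j=y_i$ if $j\in B_i$. Put $\tau_{F,\pi}=1-F_\pi^{q-1}:\mathbb{F}_q^r\to\mathbb{F}_q$ and $\mathcal{T}_{F,\pi,n}:(\mathbb{F}_q^n)^r\to\mathbb{F}_q$, $\mathcal{T}_{F,\pi,n}(y_1,\dots,y_r)=\prod_{h=1}^n\tau_{F,\pi}(y_{1,h},\dots,y_{r,h})$, where $y_{i,h}$ is the $h$-th coordinate of $y_i$. A tensor (function) $T:X_1\times\cdots\times X_r\to\mathbb{F}_q$ on finite sets is a slice if for some $i$ it can be written as $f(x_i)\,g(x_1,\dots,x_{i-1},x_{i+1},\dots,x_r)$; the slice rank $\operatorname{srk}(T)$ is the least number of slices whose sum is $T$. A sequence may have repeated values; $|S|$ is its length, and a length-$t$ subsequence consists of $t$ terms with distinct indices. *)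

(* Defs.v *)
From mathcomp Require Import all_boot all_order all_fingroup all_algebra.
From mathcomp Require Import mpoly.

Set Implicit Arguments.
Unset Strict Implicit.
Unset Printing Implicit Defensive.

Import GRing.Theory.
Local Open Scope ring_scope.

(* Set partitions of 'I_t. *)
Definition set_partitions (t : nat) : {set {set {set 'I_t}}} :=
  [set P | partition P [set: 'I_t]].

Definition one_block (t : nat) : {set {set 'I_t}} := [set [set: 'I_t]].

Definition part_coeff (t : nat) (P : {set {set 'I_t}}) : int :=
  (-1) ^+ (t - #|P|)%N * (\prod_(B in P) (#|B|.-1)`!)%N%:R.

(* The blocks of P are ordered as B_i = enum_val i, i < #|P|. The default 0 is
   reached only when P does not cover 'I_t. *)
Definition block_pullback (K : finFieldType) (t : nat) (P : {set {set 'I_t}})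
    (y : 'I_#|P| -> K) (j : 'I_t) : K :=
  if [pick i : 'I_#|P| | j \in enum_val i] is Some i then y i else 0.

Definition contraction (K : finFieldType) (t : nat) (F : {mpoly K[t]})
    (P : {set {set 'I_t}}) (y : 'I_#|P| -> K) : K :=
  F.@[block_pullback y].

Definition tau (K : finFieldType) (t : nat) (F : {mpoly K[t]})
    (P : {set {set 'I_t}}) (y : 'I_#|P| -> K) : K :=
  1 - contraction F y ^+ (#|K|.-1).

Definition zero_tensor (K : finFieldType) (t : nat) (F : {mpoly K[t]})
    (P : {set {set 'I_t}}) (n : nat) (y : 'I_#|P| -> 'rV[K]_n) : K :=
  \prod_(h < n) tau F (fun i => y i 0 h).

Definition cube (K : finFieldType) (X : {set K}) (n : nat) : {set 'rV[K]_n} :=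
  [set v : 'rV[K]_n | [forall h, v 0 h \in X]].

Definition restricted_zero_tensor (K : finFieldType) (t : nat)
    (F : {mpoly K[t]}) (P : {set {set 'I_t}}) (X : {set K}) (n : nat) :
    {ffun {ffun 'I_#|P| -> {v : 'rV[K]_n | v \in cube X n}} -> K} :=
  [ffun y : {ffun 'I_#|P| -> {v : 'rV[K]_n | v \in cube X n}} =>
    zero_tensor F (fun i => val (y i))].

Definition vanishes (K : finFieldType) (t : nat) (F : {mpoly K[t]}) (n : nat)
    (z : 'I_t -> 'rV[K]_n) : Prop :=
  forall h : 'I_n, F.@[fun j => z j 0 h] = 0.

(* Slice rank of tensors Y x ... x Y -> K with r factors; g takes the
   coordinates other than the i-th one, in order. *)
Definition is_slice (K : finFieldType) (Y : finType) (r : nat)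
    (T : {ffun {ffun 'I_r -> Y} -> K}) : bool :=
  [exists i : 'I_r, exists f : {ffun Y -> K},
   exists g : {ffun {ffun 'I_r.-1 -> Y} -> K},
   forall x : {ffun 'I_r -> Y},
     T x == f (x i) * g [ffun j => x (lift i j)]].

Definition sum_of_slices (K : finFieldType) (Y : finType) (r : nat)
    (T : {ffun {ffun 'I_r -> Y} -> K}) (m : nat) : bool :=
  [exists s : {ffun 'I_m -> {ffun {ffun 'I_r -> Y} -> K}},
    [forall k, is_slice (s k)] && (T == \sum_k s k)].

Lemma sum_of_slices_exists (K : finFieldType) (Y : finType) (r : nat)
    (T : {ffun {ffun 'I_r -> Y} -> K}) :
  exists m, (r == 0)%N || sum_of_slices T m.
Proof.
case: r T => [|r] T; first by exists 0.
exists #|{ffun 'I_r.+1 -> Y}| => /=; apply/existsP.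
exists [ffun k => [ffun x => T (enum_val k) * (x == enum_val k)%:R]].
apply/andP; split.
  apply/forallP => k; set x0 := enum_val k.
  apply/existsP; exists ord0; apply/existsP; exists [ffun a => (a == x0 ord0)%:R].
  apply/existsP; exists [ffun w => T x0 * (w == [ffun j => x0 (lift ord0 j)])%:R].
  apply/forallP => x; rewrite !ffunE mulrCA -natrM mulnb; apply/eqP.
  congr (_ * _%:R); congr nat_of_bool; apply/eqP/andP => [-> // | [/eqP e0 /eqP/ffunP e1]].
  apply/ffunP => i; case: (unliftP ord0 i) => [j ->|-> //].
  by have := e1 j; rewrite !ffunE.
apply/eqP/ffunP => x; rewrite sum_ffunE (bigD1 (enum_rank x)) //= big1.
  by rewrite !ffunE enum_rankK eqxx mulr1 addr0.
move=> k ne; rewrite !ffunE; case: eqP => [e|_]; last by rewrite mulr0.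
by rewrite e enum_valK eqxx in ne.
Qed.

(* A tensor with no factors has no slice; its rank is set to 0. *)
Definition slice_rank (K : finFieldType) (Y : finType) (r : nat)
    (T : {ffun {ffun 'I_r -> Y} -> K}) : nat :=
  ex_minn (sum_of_slices_exists T).

Definition beta (t : nat) (R : {set {set {set 'I_t}}}) : int :=
  (-1) ^+ t * (t.-1)`!%:R - \sum_(P in R) part_coeff P.

(* Main.v *)
Require Import Defs.
From mathcomp Require Import all_boot all_order all_fingroup all_algebra.
From mathcomp Require Import mpoly.
From mathcomp Require finfield.

Set Implicit Arguments.
Unset Strict Implicit.
Unset Printing Implicit Defensive.

Import GRing.Theory.
Local Open Scope ring_scope.

(** The proof combines an inclusion-exclusion formula for tuples with pairwise
distinct entries with Tao's slice rank argument, in the partition rank form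
due to Naslund.

Inclusion-exclusion ([sum_partitions_injective]).  For a tuple z, the sum of
the coefficients c_P over the set partitions P on whose blocks z is constant
is 1 if z is injective and 0 otherwise.  Multiply this by the indicator of
the coordinatewise zeros of F.  On tuples of elements of A the product
vanishes identically, because A contains no zero with pairwise distinct
entries.  On the side of the partitions, a partition P in R, as well as the
one-block partition, contributes c_P times the indicator of the diagonal: a
zero of F that is constant on the blocks of P is a zero of the contraction
F_P in every coordinate, hence is constant, and F vanishes on constant tuples.
What remains ([diagonal_identity]) is

  beta * [z is constant] = sum over the other P of
                           c_P * [z is constant on the blocks of P] * T_{F,P}(z).

Partition rank ([diagonal_partition_rank]).  As beta is nonzero, the left-hand
side is a diagonal tensor with #|A| nonzero entries.  Each slice of T_{F,P},
multiplied by the indicator of being constant on the blocks of P, is a product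
of a function of the variables in one block B and a function of the variables
outside B ([is_slice_reducible]); neither part is empty because P is not the
one-block partition.  A diagonal tensor cannot be a sum of fewer such products
than it has nonzero entries, and this is the bound on #|A|.

Sequences.  A value that occurs t times in S gives a length-t subsequence that
is constant, hence a zero of F.  So each value occurs at most t - 1 times, and
the bound for sets applies to the set of values of S. *)

(** * Inclusion-exclusion over set partitions *)

(** Every partition of S arises exactly once from a partition P of S without u,
by adding u to a block of P or as a new singleton.  The choice B = set0 stands
for the new singleton: as set0 is not a block, P :\ set0 is P. *)
Lemma sum_partitions_grow (T : finType) (V : nmodType) (S : {set T}) (u : T)
    (H : {set {set T}} -> V) : u \in S ->
  \sum_(P | partition P S) H P =
  \sum_(P | partition P (S :\ u)) \sum_(B in set0 |: P) H ((u |: B) |: P :\ B).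
Proof.
move=> uS; rewrite pair_big_dep /=.
pose grow (p : {set {set T}} * {set T}) := (u |: p.2) |: p.1 :\ p.2.
pose shrink (P : {set {set T}}) :=
  (((pblock P u :\ u) |: (P :\ pblock P u)) :\ set0, pblock P u :\ u).
have shrinkK P : partition P S -> grow (shrink P) = P.
  move=> PS; have /and3P[/eqP covP tiP P0] := PS.
  have uP : u \in cover P by rewrite covP.
  have CP := pblock_mem uP; have uC : u \in pblock P u by rewrite mem_pblock.
  rewrite /grow /shrink /= setD1K //; set C := pblock P u in CP uC *.
  (* If C is {u} the inserted set is empty and gets removed; otherwise it is
     a nonempty subset of C, hence none of the other blocks. *)
  have -> : ((C :\ u |: P :\ C) :\ set0) :\ (C :\ u) = P :\ C.
    apply/setP => B; rewrite !inE.
    have [-> | nB] /= := eqVneq B (C :\ u).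
      apply/esym/negP => /andP[nC CuP].
      have /set0Pn[x] : C :\ u != set0 by apply: contraNneq P0 => <-.
      rewrite !inE => /andP[xu xC]; case/eqP: nC.
      have xCu : x \in C :\ u by rewrite !inE xu.
      by rewrite -(def_pblock tiP CuP xCu) (def_pblock tiP CP xC).
    by have [-> | //] := eqVneq B set0; rewrite (negPf P0) andbF.
  exact: setD1K.
rewrite (reindex_onto grow shrink) /=; last by move=> P; apply: shrinkK.
apply: eq_bigl => -[P B] /=; apply/andP/andP => [[QS /eqP defPB] | [PS BP]].
  move: (grow _) QS defPB => Q QS defPB; have /and3P[/eqP covQ tiQ Q0] := QS.
  have uQ : u \in cover Q by rewrite covQ.
  have CQ := pblock_mem uQ; have uC : u \in pblock Q u by rewrite mem_pblock.
  case: defPB => <- <-; set C := pblock Q u in CQ uC *.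
  split; last first.
    by rewrite !inE eqxx andbT orbN.
  have part' := partitionD1 QS CQ.
  have sCS : C \subset S by rewrite -covQ; apply: bigcup_sup CQ.
  have eqS : (C :\ u) :|: (S :\: C) = S :\ u.
    apply/setP => x; rewrite !inE; have [-> | xu] /= := eqVneq x u.
      by rewrite uC.
    by case xC: (x \in C) => //=; rewrite (subsetP sCS).
  have [Cu0 | Cu0] := eqVneq (C :\ u) set0.
    rewrite Cu0 set0U in eqS; rewrite Cu0 -eqS.
    by rewrite setU1K // !inE (negPf Q0) andbF.
  have -> : ((C :\ u) |: Q :\ C) :\ set0 = (C :\ u) |: Q :\ C.
    apply/setP => D; rewrite !inE; have [-> /= | //] := eqVneq D set0.
    by rewrite (negPf Q0) andbF orbF eq_sym (negPf Cu0).
  rewrite -eqS; apply: partitionU1 => //.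
  rewrite -setI_eq0; apply/eqP/setP => x; rewrite !inE.
  by case: (x \in C); rewrite ?andbF.
have /and3P[/eqP covP tiP P0] := PS.
have uB : u \notin B.
  have : u \notin S :\ u by rewrite !inE eqxx.
  apply: contra => uB; rewrite -covP; apply/bigcupP; exists B => //.
  by move: BP; rewrite !inE => /orP[/eqP B0|//]; rewrite B0 inE in uB.
have uP : u |: B \notin P :\ B.
  rewrite !inE negb_and; apply/orP; right.
  apply/negP => uBP; have : u \in cover P.
    by apply/bigcupP; exists (u |: B); rewrite ?setU11.
  by rewrite covP !inE eqxx.
have QS : partition (grow (P, B)) S.
  rewrite /grow /=.
  have sBS : B \subset S :\ u.
    move: BP; rewrite !inE => /orP[/eqP->|BP]; first exact: sub0set.
    by rewrite -covP; apply: bigcup_sup BP.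
  have part' : partition (P :\ B) ((S :\ u) :\: B).
    move: BP; rewrite !inE => /orP[/eqP B0|BP]; last exact: partitionD1.
    rewrite B0 setD0; suff -> : P :\ set0 = P by [].
    by apply/setP => D; rewrite !inE; have [->|//] := eqVneq; rewrite (negPf P0).
  have -> : S = (u |: B) :|: ((S :\ u) :\: B).
    apply/setP => x; rewrite !inE; have [-> | xu] //= := eqVneq x u.
    case xB: (x \in B) => //=; have := subsetP sBS _ xB; by rewrite !inE xu.
  apply: partitionU1 => //.
    by apply/set0Pn; exists u; rewrite setU11.
  rewrite -setI_eq0; apply/eqP/setP => x; rewrite !inE.
  by have [-> | ] /= := eqVneq x u; rewrite ?andbF //; case: (x \in B).
split=> //; have /and3P[_ tiQ _] := QS.
have -> : shrink (grow (P, B)) =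
    (((u |: B) :\ u |: grow (P, B) :\ (u |: B)) :\ set0, (u |: B) :\ u).
  rewrite /shrink; suff -> : pblock (grow (P, B)) u = u |: B by [].
  by apply: def_pblock => //; rewrite /grow /= setU11.
rewrite setU1K // xpair_eqE eqxx andbT /grow /= setU1K //; apply/eqP/setP => D.
move: BP; rewrite !inE; have [-> /= | D0] /= := eqVneq D set0.
  by rewrite (negPf P0).
have [DB | //] := eqVneq D B.
by rewrite -DB (negPf D0) => /= ->.
Qed.

Definition const_on (T : finType) (Y : eqType) (z : T -> Y) (B : {set T}) : bool :=
  [forall i in B, forall j in B, z i == z j].

Lemma const_onP (T : finType) (Y : eqType) (z : T -> Y) (B : {set T}) :
  reflect {in B &, forall i j, z i = z j} (const_on z B).
Proof.
apply: (iffP 'forall_in_'forall_in_eqP); first by move=> h i j iB jB; apply: h.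
by move=> h i iB j jB; apply: h.
Qed.

(** The product of the block weights of a partition P is its coefficient c_P,
which is the Moebius function of the partition lattice between the partition
into singletons and P, if z is constant on every block, and 0 otherwise. *)
Definition block_weight (T : finType) (Y : eqType) (z : T -> Y)
    (B : {set T}) : int :=
  (-1) ^+ #|B|.-1 * (#|B|.-1)`!%:R * (const_on z B)%:R.

Lemma block_weight1 (T : finType) (Y : eqType) (z : T -> Y) (u : T) :
  block_weight z [set u] = 1.
Proof.
rewrite /block_weight cards1 !mul1r.
suff -> : const_on z [set u] by [].
by apply/const_onP => i j /set1P-> /set1P->.
Qed.

(** If z is not constant on B then both sides are 0.  Otherwise the sum is #|B| or 0
according to whether z takes the value z u on B, and the factor - #|B| turns
(-1) ^ (#|B| - 1) (#|B| - 1)! into the same expression for #|B| + 1. *)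
Lemma block_weightU1 (T : finType) (Y : eqType) (z : T -> Y) (u : T) (B : {set T}) :
  B != set0 -> u \notin B ->
  block_weight z (u |: B) = - (\sum_(j in B) (z j == z u)%:R) * block_weight z B.
Proof.
move=> /[dup] B0 /set0Pn[b bB] uB.
rewrite /block_weight cardsU1 uB add1n /=.
have /prednK cardB : (0 < #|B|)%N by rewrite card_gt0.
case: (const_onP z B) => [cB | ncB]; last first.
  rewrite !mulr0; case: const_onP => [cuB|]; last by rewrite mulr0.
  by case: ncB => i j iB jB; apply: cuB; rewrite setU1r.
rewrite (eq_bigr (fun=> (z b == z u)%:R)) => [|j jB]; last by rewrite (cB j b).
rewrite sumr_const; have [zbu | zbu] := eqVneq (z b) (z u); last first.
  rewrite mul0rn oppr0 mul0r; case: const_onP => [cuB|]; last by rewrite mulr0.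
  by case/eqP: zbu; apply: cuB; rewrite ?setU11 ?setU1r.
suff -> : const_on z (u |: B).
  rewrite -[in LHS]cardB exprS factS natrM.
  rewrite [in RHS](_ : true%:R *+ #|B| = (#|B|.-1.+1)%:R :> int) ?cardB //.
  by rewrite !mulr1 !mulNr !mul1r mulrCA.
apply/const_onP => i j /setU1P[->|iB] /setU1P[->|jB] //.
all: by rewrite -?zbu; apply: cB.
Qed.

(** Induction on S.  By [sum_partitions_grow], restoring a point u of S creates
either a new singleton, of weight 1, or an enlarged block, whose weight is given
by [block_weightU1].  The blocks of a partition cover S :\ u, so this multiplies the sum over the partitions of S :\ u by 1 - k, where k is the
number of points j != u of S with z j = z u.  If z is injective on S :\ u then
k is 0 or 1, and k = 0 exactly when z is injective on S. *)
Lemma sum_partitions_injective (T : finType) (Y : eqType) (z : T -> Y)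
    (S : {set T}) :
  \sum_(P | partition P S) \prod_(B in P) block_weight z B =
  (dinjectiveb z (mem S))%:R.
Proof.
elim: {S}_.+1 {-2}S (ltnSn #|S|) => // m IHm S leSm.
have [-> | /set0Pn[u uS]] := eqVneq S set0.
  rewrite (eq_bigl (pred1 set0)) => [|P]; last by rewrite partition_set0.
  rewrite big_pred1_eq big_set0; case: dinjectiveP => // -[] i j.
  by rewrite inE.
rewrite (sum_partitions_grow _ uS).
transitivity (\sum_(P | partition P (S :\ u))
   (1 - \sum_(j in S :\ u) (z j == z u)%:R) * \prod_(B in P) block_weight z B).
  apply: eq_bigr => P PS; have /and3P[/eqP covP tiP P0] := PS.
  have notuP B : B \in P -> u \notin B.
    move=> BP; apply/negP => uB; have : u \in cover P by apply/bigcupP; exists B.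
    by rewrite covP !inE eqxx.
  have uBP B : u |: B \notin P.
    by apply/negP => /notuP; rewrite setU11.
  rewrite big_setU1 //= setU0 mulrBl mul1r; congr (_ + _).
    have -> : P :\ set0 = P.
      by apply/setP => D; rewrite !inE; have [->|//] := eqVneq; rewrite (negPf P0).
    rewrite big_setU1 /=; last by have := uBP set0; rewrite setU0.
    by rewrite block_weight1 mul1r.
  rewrite -covP big_trivIset //= mulr_suml -sumrN; apply: eq_bigr => B BP.
  rewrite big_setU1 /=; last by rewrite !inE (negPf (uBP B)) andbF.
  rewrite block_weightU1 ?notuP ?(partition_neq0 PS BP) //.
  by rewrite (big_setD1 B BP) /= -!mulrA mulNr.
rewrite -mulr_sumr IHm; last by rewrite (cardsD1 u S) uS in leSm.
case: dinjectiveP => [injS' | ninjS']; last first.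
  rewrite mulr0; case: dinjectiveP => // injS; case: ninjS' => i j.
  by rewrite !inE => /andP[_ iS] /andP[_ jS]; apply: injS.
rewrite mulr1.
have [[j0 j0S /eqP zj0] | nj] :=
    altP (@exists_inP _ (mem (S :\ u)) (fun j => z j == z u)).
  rewrite (bigD1 j0) //= zj0 eqxx big1 => [|j /andP[jS jj0]]; last first.
    rewrite -zj0; case: eqP => // /(injS' _ _ jS j0S) ejj.
    by rewrite ejj eqxx in jj0.
  rewrite addr0 subrr; case: dinjectiveP => // injS.
  move: j0S; rewrite !inE => /andP[j0u j0S].
  by rewrite (injS _ _ j0S uS zj0) eqxx in j0u.
have {nj} zu j : j \in S :\ u -> (z j == z u) = false.
  by move=> jS; apply/negP => e; case/exists_inP: nj; exists j.
rewrite big1 ?subr0 => [|j /zu-> //].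
suff /dinjectiveP -> : {in S &, injective z} by [].
move=> i j iS jS zij.
have [iu|iu] := eqVneq i u; have [ju|ju] := eqVneq j u.
- by rewrite iu ju.
- by have := zu j; rewrite !inE ju jS => /(_ isT); rewrite -zij iu eqxx.
- by have := zu i; rewrite !inE iu iS => /(_ isT); rewrite zij ju eqxx.
- by apply: injS'; rewrite // !inE ?iu ?ju.
Qed.

(** * The partition rank of a diagonal tensor *)

Lemma exists_orthogonal (K : fieldType) (Y I : finType) (Q : {set I})
    (phi : I -> Y -> K) (S : {set Y}) : (#|Q| < #|S|)%N ->
  exists w : Y -> K,
    [/\ forall i, i \in Q -> \sum_a w a * phi i a = 0,
        forall a, a \notin S -> w a = 0
      & exists2 a, a \in S & w a != 0].
Proof.
move=> ltQS.
pose M : 'M_(#|S|, #|Q|) := \matrix_(a, i) phi (enum_val i) (enum_val a).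
have /rowV0Pn[v /sub_kermxP vM v0] : kermx M != 0.
  rewrite -mxrank_eq0 mxrank_ker subn_eq0 -ltnNge.
  by rewrite (leq_ltn_trans (rank_leq_col M)).
pose w a := \sum_(k < #|S|) v 0 k *+ (enum_val k == a).
have wE k : w (enum_val k) = v 0 k.
  rewrite /w (bigD1 k) //= eqxx big1 ?addr0 // => k' k'k.
  by rewrite (inj_eq enum_val_inj) (negPf k'k).
have w0 a : a \notin S -> w a = 0.
  move=> aS; rewrite /w big1 // => k _; case: eqP => // ka.
  by rewrite -ka enum_valP in aS.
exists w; split=> // [i iQ | ].
  have /(congr1 (fun A : 'rV_#|Q| => A 0 (enum_rank_in iQ i))) := vM.
  rewrite !mxE => vM0; rewrite -[RHS]vM0 (bigID (mem S)) /= addrC big1 => [|a aS].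
    rewrite add0r big_enum_val; apply: eq_bigr => k _.
    by rewrite wE mxE enum_rankK_in.
  by rewrite w0 ?mul0r.
have /rV0Pn[k vk] := v0; exists (enum_val k); first exact: enum_valP.
by rewrite wE.
Qed.

(** The support can be enlarged as long as it leaves more than #|Q| points of S
uncovered: the previous lemma gives a nonzero solution w supported on these
points, and adding w leaves the values on the old support unchanged. *)
Lemma exists_orthogonal_large_support (K : fieldType) (Y I : finType)
    (Q : {set I}) (phi : I -> Y -> K) (S : {set Y}) :
  exists2 h : Y -> K,
    forall i, i \in Q -> \sum_a h a * phi i a = 0
  & (#|S| <= #|[set a in S | h a != 0%R]| + #|Q|)%N.
Proof.
suff large m : (m + #|Q| <= #|S|)%N -> exists2 h : Y -> K,
    forall i, i \in Q -> \sum_a h a * phi i a = 0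
  & (m <= #|[set a in S | h a != 0%R]|)%N.
  have [leQS | /ltnW leSQ] := leqP #|Q| #|S|.
    have [|h horth mh] := large (#|S| - #|Q|)%N; first by rewrite subnK.
    by exists h; rewrite // -leq_subLR; move: mh; rewrite !leq_subLR addnC.
  exists (fun=> 0) => [i _|]; last exact: leq_trans leSQ (leq_addl _ _).
  by rewrite big1 // => a _; rewrite mul0r.
elim: m => [_|m IHm mS].
  by exists (fun=> 0) => // i _; rewrite big1 // => a _; rewrite mul0r.
have [h horth mh] := IHm (ltnW mS); set U := [set a in S | _] in mh.
have [ltmU | leUm] := ltnP m #|U|; first by exists h.
have US : U \subset S by apply/subsetP => a; rewrite inE => /andP[].
have [|w [worth w0 [a aSU wa]]] := @exists_orthogonal _ _ _ Q phi (S :\: U).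
  rewrite cardsD (setIidPr US) ltn_subRL; apply: leq_trans mS.
  by rewrite ltnS leq_add2r.
exists (fun b => h b + w b) => [i iQ|].
  under eq_bigr do rewrite mulrDl.
  by rewrite big_split /= horth // worth // addr0.
have aU : a \notin U by move: aSU; rewrite inE => /andP[].
apply: leq_ltn_trans mh _; apply: leq_trans (_ : #|a |: U| <= _)%N.
  by rewrite cardsU1 aU.
apply/subset_leq_card/subsetP => b /setU1P[->|bU].
  move: aSU aU; rewrite !inE => /andP[naU aS]; rewrite aS /= in naU *.
  by rewrite negbK => /eqP ->; rewrite add0r.
have := bU; rewrite !inE => /andP[-> hb]; rewrite w0 ?addr0 //.
by rewrite inE bU.
Qed.

Definition depends_on (J Y : Type) (K : eqType) (C : pred J) (f : (J -> Y) -> K) :=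
  forall z z', (forall j, C j -> z j = z' j) -> f z = f z'.

(** The tensors of partition rank at most one in the variables of U.  Keeping
the variables as functions on all of J, with only those in U relevant, makes it
possible to remove one variable without changing the type of the tensor. *)
Definition reducible (K : fieldType) (J : finType) (Y : Type) (U : {set J})
    (T : (J -> Y) -> K) : Prop :=
  exists (B : {set J}) (f g : (J -> Y) -> K),
    [/\ U :&: B != set0, U :\: B != set0,
        depends_on (mem (U :&: B)) f, depends_on (mem (U :\: B)) g
      & forall z, T z = f z * g z].

Lemma reducible_side (K : fieldType) (J : finType) (Y : Type) (U : {set J})
    (T : (J -> Y) -> K) (u : J) : u \in U -> reducible U T ->
  exists (B : {set J}) (f g : (J -> Y) -> K),
    [/\ u \in B, U :\: B != set0,
        depends_on (mem (U :&: B)) f, depends_on (mem (U :\: B)) g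
      & forall z, T z = f z * g z].
Proof.
move=> uU [B [f [g [UB0 UDB0 df dg Tfg]]]].
have [uB | uB] := boolP (u \in B); first by exists B, f, g.
exists (~: B), g, f; split=> [||||z].
- by rewrite inE.
- by rewrite setDE setCK.
- by rewrite -setDE.
- by rewrite setDE setCK.
- by rewrite Tfg mulrC.
Qed.

Definition upd (J : eqType) (Y : Type) (z : J -> Y) (u : J) (a : Y) : J -> Y :=
  fun j => if j == u then a else z j.

(** Summing a tensor T = f g over the variable u against weights h.  If f
depends on u alone, this is the scalar product of h with a fixed vector phi,
times g; otherwise the summed f still has a variable left and the result is
again reducible. *)
Lemma reducible_contract (K : fieldType) (J Y : finType) (U : {set J})
    (T : (J -> Y) -> K) (u : J) : u \in U -> reducible U T ->
  exists (b : bool) (phi : Y -> K), forall h : Y -> K,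
    if b then \sum_a h a * phi a = 0 -> forall z, \sum_a h a * T (upd z u a) = 0
    else reducible (U :\ u) (fun z => \sum_a h a * T (upd z u a)).
Proof.
move=> uU /(reducible_side uU)[B [f [g [uB UDB0 df dg Tfg]]]].
have gu z a : g (upd z u a) = g z.
  by apply: dg => j /=; rewrite !inE /upd; have [->|] := eqVneq j u; rewrite ?uB.
have TE (h : Y -> K) z :
    \sum_a h a * T (upd z u a) = (\sum_a h a * f (upd z u a)) * g z.
  by rewrite mulr_suml; apply: eq_bigr => a _; rewrite Tfg gu mulrA.
have [UB1 | UBn1] := eqVneq (U :&: B) [set u].
  exists true, (fun a => f (fun=> a)) => h horth z.
  rewrite TE (eq_bigr (fun a => h a * f (fun=> a))) ?horth ?mul0r // => a _.
  by congr (_ * _); apply: df => j; rewrite UB1 /= inE /upd => ->.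
exists false, (fun=> 0) => h.
exists B, (fun z => \sum_a h a * f (upd z u a)), g; split.
- apply: contra UBn1 => /eqP e; apply/eqP/setP => j; move/setP/(_ j): e.
  by rewrite !inE; have [->|] := eqVneq j u; rewrite ?uB ?uU.
- suff -> : (U :\ u) :\: B = U :\: B by [].
  by apply/setP => j; rewrite !inE; have [->|] := eqVneq j u; rewrite ?uB.
- move=> z z' zz'; apply: eq_bigr => a _; congr (_ * _); apply: df => j /=.
  rewrite !inE /upd => /andP[jU jB]; case: eqP => // /eqP ju.
  by apply: zz'; rewrite /= !inE ju jU.
- move=> z z' zz'; apply: dg => j /=; rewrite !inE => /andP[jB jU].
  apply: zz'; rewrite /= !inE jU jB andbT.
  by apply: contraNneq jB => ->.
- exact: TE.
Qed.

(** Induction on the number of variables.  Let Q1 be the set of terms with a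
factor that depends on u alone.  Contracting the variable u against weights h
that are orthogonal to all these factors removes the terms of Q1 and leaves a
diagonal tensor with entries d a * h a.  The weights can be chosen to vanish at
no more than #|Q1| points of the support of d, so the number of nonzero entries
drops by no more than the number of terms removed.  With one variable there are no
reducible tensors at all, and the diagonal must be 0. *)
Lemma diagonal_partition_rank (K : fieldType) (J Y I : finType) (U : {set J})
    (Q : {set I}) (T : I -> (J -> Y) -> K) (d : Y -> K) : U != set0 ->
  (forall i, i \in Q -> reducible U (T i)) ->
  (forall z, \sum_(i in Q) T i z = \sum_a d a * \prod_(j in U) (z j == a)%:R) ->
  (#|[set a | d a != 0%R]| <= #|Q|)%N.
Proof.
elim: {U}_.+1 {-2}U (ltnSn #|U|) Q T d => // m IHm U leUm Q T d U0 redT sumT.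
have [u uU] := set0Pn _ U0.
have [Uu0 | Uu0] := eqVneq (U :\ u) set0.
  have Uu : U = [set u] by rewrite -(setD1K uU) Uu0 setU0.
  have Q0 i : i \in Q -> False.
    move=> /redT [B [f [g [/set0Pn[j] + /set0Pn[k] + _ _ _]]]]; rewrite Uu !inE.
    move=> /andP[/eqP-> uB] /andP[kB /eqP ku].
    by rewrite ku uB in kB.
  rewrite (_ : [set a | _] = set0) ?cards0 //; apply/setP => a; rewrite !inE.
  have := sumT (fun=> a); rewrite big1 => [|i /Q0 //].
  rewrite (bigD1 a) //= Uu big_set1 eqxx mulr1 big1 ?addr0 => [<-|b ba].
    by rewrite eqxx.
  by rewrite big_set1 eq_sym (negPf ba) mulr0.
have /fin_all_exists[b /fin_all_exists[phi bphi]] i : exists b phi, i \in Q ->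
    forall h : Y -> K, if b then \sum_a h a * phi a = 0 ->
       forall z, \sum_a h a * T i (upd z u a) = 0
    else reducible (U :\ u) (fun z => \sum_a h a * T i (upd z u a)).
  have [iQ | _] := boolP (i \in Q); last by exists true, (fun=> 0).
  by have [b [phi H]] := reducible_contract uU (redT i iQ); exists b, phi.
pose Q1 := [set i in Q | b i]; pose Q2 := [set i in Q | ~~ b i].
have cardQ : #|Q| = (#|Q2| + #|Q1|)%N.
  rewrite -(cardsID [set i | b i] Q) addnC /Q1 /Q2.
  congr (_ + _)%N; apply: eq_card => i.
    by rewrite !inE andbC.
  by rewrite !inE.
have [h horth hsupp] :=
  exists_orthogonal_large_support Q1 phi [set a | d a != 0].
rewrite cardQ; apply: leq_trans hsupp _; rewrite leq_add2r.
have -> : [set a in [set a | d a != 0] | h a != 0] = [set a | d a * h a != 0].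
  by apply/setP => a; rewrite !inE mulf_eq0 negb_or.
pose T' i z := \sum_a h a * T i (upd z u a).
apply: (IHm (U :\ u) _ Q2 T') => //.
- by rewrite (cardsD1 u U) uU in leUm.
- move=> i; rewrite inE => /andP[iQ nbi].
  by have := bphi i iQ h; rewrite (negPf nbi).
move=> z; transitivity (\sum_(i in Q) T' i z).
  rewrite [RHS](bigID b) /= [X in X + _]big1 ?add0r => [|i /andP[iQ bi]].
    by apply: eq_bigl => i; rewrite inE.
  have := bphi i iQ h; rewrite bi => H; apply: H; apply: horth.
  by rewrite inE iQ.
rewrite exchange_big /=.
transitivity (\sum_a \sum_c h a * (d c * \prod_(j in U) (upd z u a j == c)%:R)).
  by apply: eq_bigr => a _; rewrite -!mulr_sumr sumT.
rewrite exchange_big; apply: eq_bigr => c _ /=.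
rewrite (bigD1 c) //= [X in _ + X]big1 ?addr0 => [|a ac]; last first.
  by rewrite (big_setD1 u) //= /upd eqxx (negPf ac) mul0r !mulr0.
rewrite (big_setD1 u) //= {1}/upd !eqxx mul1r mulrA [h c * _]mulrC.
congr (_ * _); apply: eq_bigr => j; rewrite !inE => /andP[ju _].
by rewrite /upd (negPf ju).
Qed.

(** * From slices to reducible tensors *)

Lemma const_on_depends (T : finType) (Y : eqType) (B : {set T}) (z z' : T -> Y) :
  {in B, z =1 z'} -> const_on z B = const_on z' B.
Proof.
move=> zz'; apply/const_onP/const_onP => cB i j iB jB.
  by rewrite -!zz' //; apply: cB.
by rewrite !zz' //; apply: cB.
Qed.

(** A slice separates the variable of one block B = B_i from those of the other
blocks.  The indicator of being constant on all blocks factors in the same way,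
so replacing the variable of a block by the entry of z at a representative of
that block separates B from its complement.  The map e allows the tensor to be
restricted to a smaller set of values. *)
Lemma is_slice_reducible (K : finFieldType) (J Y Y' : finType) (e : Y' -> Y)
    (P : {set {set J}}) (rep : {set J} -> J) (c : K)
    (T : {ffun {ffun 'I_#|P| -> Y} -> K}) :
  partition P [set: J] -> P != [set [set: J]] ->
  {in P, forall B : {set J}, rep B \in B} -> is_slice T ->
  reducible [set: J] (fun z : J -> Y' =>
    c * [forall B in P, const_on z B]%:R * T [ffun i => e (z (rep (enum_val i)))]).
Proof.
move=> PJ Pn1 repP /existsP[i /existsP[f /existsP[g /forallP Tfg]]].
have /and3P[/eqP covP tiP P0] := PJ.
set B := enum_val i; have BP : B \in P := enum_valP i.
exists B, (fun z => c * (const_on z B)%:R * f (e (z (rep B)))).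
exists (fun z => [forall C in P :\ B, const_on z C]%:R *
  g [ffun k => e (z (rep (enum_val (lift i k))))]).
have outB C k : C \in P :\ B -> k \in C -> k \in [set: J] :\: B.
  rewrite !inE => /andP[CB CP] kC; rewrite andbT; apply: contra CB => kB.
  by rewrite -(def_pblock tiP CP kC) -(def_pblock tiP BP kB).
split.
- by rewrite setTI (partition_neq0 PJ BP).
- apply: contra Pn1; rewrite setD_eq0 subTset => /eqP BT.
  apply/eqP/setP => C; rewrite inE; apply/idP/eqP => [CP | ->]; last by rewrite -BT.
  have /set0Pn[k kC] := partition_neq0 PJ CP.
  rewrite -(def_pblock tiP CP kC) -BT; apply: def_pblock => //.
  by rewrite BT inE.
- move=> z z' zz'; rewrite (@const_on_depends _ _ _ z z') => [|j jB].
    by rewrite zz' //= !inE repP.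
  by rewrite zz' //= !inE.
- move=> z z' zz'; congr (_%:R * g _).
    congr nat_of_bool; apply: eq_forallb_in => C CP.
    by apply: const_on_depends => j jC; apply: zz'; apply: outB jC.
  apply/ffunP => k; rewrite !ffunE; congr (e _); apply: zz'.
  apply: outB (_ : _ \in enum_val (lift i k)).
    rewrite !inE enum_valP andbT (inj_eq enum_val_inj).
    by rewrite eq_sym neq_lift.
  by apply/repP/enum_valP.
move=> z; rewrite (eqP (Tfg _)) ffunE -!mulrA; congr (_ * _).
have -> : [ffun k => [ffun i0 => e (z (rep (enum_val i0)))] (lift i k)] =
   [ffun k => e (z (rep (enum_val (lift i k))))].
  by apply/ffunP => k; rewrite !ffunE.
have -> : [forall C in P, const_on z C] =
    const_on z B && [forall C in P :\ B, const_on z C].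
  apply/forall_inP/andP => [cP | [cB /forall_inP cPB] C CP].
    by split; [apply: cP | apply/forall_inP => C /setD1P[_ /cP]].
  by have [-> // | CB] := eqVneq C B; apply: cPB; rewrite !inE CB.
by rewrite -mulnb natrM -!mulrA; congr (_ * _); rewrite mulrCA.
Qed.

Lemma slice_rank_reducible (K : finFieldType) (J Y Y' : finType) (e : Y' -> Y)
    (P : {set {set J}}) (rep : {set J} -> J) (c : K)
    (T : {ffun {ffun 'I_#|P| -> Y} -> K}) :
  partition P [set: J] -> P != [set [set: J]] -> P != set0 ->
  {in P, forall B : {set J}, rep B \in B} ->
  exists S : 'I_(slice_rank T) -> (J -> Y') -> K,
    (forall k, reducible [set: J] (S k)) /\
    forall z, c * [forall B in P, const_on z B]%:R *
        T [ffun i => e (z (rep (enum_val i)))] = \sum_k S k z.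
Proof.
move=> PJ Pn1 Pn0 repP; rewrite /slice_rank; case: ex_minnP => m + _.
rewrite cards_eq0 (negPf Pn0) /= => /existsP[s /andP[/forallP sliceS /eqP Ts]].
exists (fun k z => c * [forall B in P, const_on z B]%:R *
                   s k [ffun i => e (z (rep (enum_val i)))]).
split=> [k | z]; first exact: (is_slice_reducible e c PJ Pn1 repP (sliceS k)).
by rewrite -mulr_sumr Ts sum_ffunE.
Qed.

(** * The diagonal identity *)

Lemma part_coeff_const_on (t : nat) (Y : eqType) (z : 'I_t -> Y)
    (P : {set {set 'I_t}}) : partition P [set: 'I_t] ->
  part_coeff P * [forall B in P, const_on z B]%:R =
  \prod_(B in P) block_weight z B.
Proof.
move=> PT; rewrite /block_weight /part_coeff !big_split /=; congr (_ * _ * _).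
- rewrite -expr_sum; congr (_ ^+ _).
  under [RHS]eq_bigr do rewrite -subn1.
  rewrite sumnB => [|B BP]; last by rewrite card_gt0 (partition_neq0 PT BP).
  by rewrite sum1_card -(card_partition PT) cardsT card_ord.
- by rewrite natr_prod.
rewrite -big_andE; elim/big_rec2: _ => //= B b c BP <-.
by rewrite -mulnb natrM.
Qed.

Lemma one_sub_expf_card (K : finFieldType) (x : K) :
  1 - x ^+ #|K|.-1 = (x == 0)%:R.
Proof.
have cardK := card_finNzRing_gt1 K.
have [-> | x0] := eqVneq x 0.
  by rewrite expr0n -[_ == 0%N]negbK -lt0n -subn1 subn_gt0 cardK subr0.
apply/eqP; rewrite subr_eq0 eq_sym; apply/eqP/(mulfI x0).
by rewrite mulr1 -exprS prednK ?(ltnW cardK) // finfield.expf_card.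
Qed.

Lemma block_pullback_const_on (K : finFieldType) (t : nat) (P : {set {set 'I_t}})
    (rep : {set 'I_t} -> 'I_t) (z : 'I_t -> K) :
  partition P [set: 'I_t] -> {in P, forall B : {set 'I_t}, rep B \in B} ->
  {in P, forall B, const_on z B} ->
  block_pullback (fun i : 'I_#|P| => z (rep (enum_val i))) =1 z.
Proof.
move=> PT repP cP j; rewrite /block_pullback; case: pickP => [i ji | noB].
  have BP := enum_valP i.
  by move/const_onP: (cP _ BP); apply=> //; apply: repP.
have /bigcupP[B BP jB] : j \in cover P by rewrite (cover_partition PT) inE.
by have := noB (enum_rank_in BP B); rewrite enum_rankK_in ?jB.
Qed.

Definition zeros (K : finFieldType) (t n : nat) (F : {mpoly K[t]})
    (z : 'I_t -> 'rV[K]_n) : bool :=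
  [forall h, F.@[fun j => z j 0 h] == 0].

Lemma zero_tensor_const_on (K : finFieldType) (t n : nat) (F : {mpoly K[t]})
    (P : {set {set 'I_t}}) (rep : {set 'I_t} -> 'I_t) (z : 'I_t -> 'rV[K]_n) :
  partition P [set: 'I_t] -> {in P, forall B : {set 'I_t}, rep B \in B} ->
  {in P, forall B, const_on z B} ->
  zero_tensor F (fun i : 'I_#|P| => z (rep (enum_val i))) = (zeros F z)%:R.
Proof.
move=> PT repP cP; rewrite /zero_tensor.
have -> : zeros F z = \big[andb/true]_(h < n) (F.@[fun j => z j 0 h] == 0).
  by rewrite big_andE.
rewrite (eq_bigr (fun h => (F.@[fun j => z j 0 h] == 0)%:R)) => [|h _].
  elim/big_rec2: _ => //= h b c _ ->.
  by rewrite -mulnb natrM.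
rewrite /tau one_sub_expf_card /contraction; congr (_ == 0)%:R.
apply/meval_eq/block_pullback_const_on => // B BP.
by apply/const_onP => i j iB jB; have /const_onP/(_ i j iB jB)-> := cP B BP.
Qed.

Lemma partition_rep (T : finType) (x : T) (P : {set {set T}}) (D : {set T}) :
  partition P D ->
  exists rep : {set T} -> T, {in P, forall B : {set T}, rep B \in B}.
Proof.
move=> PD; apply: (fin_all_exists (P := fun B u => B \in P -> u \in B)) => B.
have [BP | nBP] := boolP (B \in P); last by exists x.
by have /set0Pn[u uB] := partition_neq0 PD BP; exists u.
Qed.

(** Each coordinate of z is constant on the blocks of P, so it defines a zero of
the contraction of F along P with entries in X; such a zero is constant. *)
Lemma zeros_singular (K : finFieldType) (X : {set K}) (t n : nat)
    (F : {mpoly K[t]}) (P : {set {set 'I_t}}) (z : 'I_t -> 'rV[K]_n) :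
  (forall y : 'I_#|P| -> K, (forall i, y i \in X) ->
     contraction F y = 0 -> forall i j, y i = y j) ->
  partition P [set: 'I_t] -> {in P, forall B, const_on z B} ->
  (forall j, z j \in cube X n) -> zeros F z -> const_on z [set: 'I_t].
Proof.
move=> singP PT cP zX /forallP Fz; apply/const_onP => j k _ _.
have [rep repP] := partition_rep j PT.
apply/rowP => h; pose zh i := z i 0 h.
have czh : {in P, forall B, const_on zh B}.
  move=> B BP; apply/const_onP => i l iB lB.
  by rewrite /zh; have /const_onP/(_ i l iB lB)-> := cP B BP.
have pullE := block_pullback_const_on PT repP czh.
have blockE i : exists b : 'I_#|P|, zh i = zh (rep (enum_val b)).
  have := pullE i; rewrite /block_pullback; case: pickP => [b _ <- | noB _].
    by exists b.
  have /bigcupP[B BP iB] : i \in cover P by rewrite (cover_partition PT) inE.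
  by have := noB (enum_rank_in BP B); rewrite enum_rankK_in ?iB.
rewrite -[LHS]/(zh j) -[RHS]/(zh k).
have [b ->] := blockE j; have [c ->] := blockE k.
apply: (singP (fun b => zh (rep (enum_val b)))) => [l|].
  by have := zX (rep (enum_val l)); rewrite inE => /forallP/(_ h).
by rewrite /contraction (meval_eq _ pullE); apply/eqP/Fz.
Qed.

Lemma zeros_const_on (K : finFieldType) (X : {set K}) (t n : nat)
    (F : {mpoly K[t]}) (z : 'I_t -> 'rV[K]_n) (j : 'I_t) :
  (forall a, a \in X -> F.@[fun _ => a] = 0) ->
  z j \in cube X n -> const_on z [set: 'I_t] -> zeros F z.
Proof.
rewrite inE => FX /forallP zX /const_onP cz; apply/forallP => h; apply/eqP.
by rewrite -(FX (z j 0 h)) //; apply: meval_eq => k; rewrite (cz k j) ?inE.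
Qed.

(** The inclusion-exclusion formula multiplied by the indicator of the zeros of
F vanishes at z.  The partitions in R and the one-block partition contribute
multiples of the indicator of the diagonal, and minus the sum of their
coefficients is beta. *)
Lemma diagonal_identity (K : finFieldType) (X : {set K}) (t n : nat)
    (F : {mpoly K[t]}) (R : {set {set {set 'I_t}}}) (z : 'I_t -> 'rV[K]_n) :
  (0 < t)%N ->
  (forall a : K, a \in X -> F.@[fun _ => a] = 0) ->
  R \subset set_partitions t :\ one_block t ->
  (forall P : {set {set 'I_t}}, P \in R ->
     forall y : 'I_#|P| -> K, (forall i, y i \in X) ->
       contraction F y = 0 -> forall i j, y i = y j) ->
  (forall j, z j \in cube X n) -> ~ (injective z /\ zeros F z) ->
  \sum_(P in set_partitions t :\: (R :|: [set one_block t]))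
     (part_coeff P)%:~R * [forall B in P, const_on z B]%:R * (zeros F z)%:R
  = (beta R)%:~R * (const_on z [set: 'I_t])%:R :> K.
Proof.
move=> t0 FX sR singR zX noz; pose j0 := Ordinal t0.
have T0 : [set: 'I_t] != set0 by apply/set0Pn; exists j0; rewrite inE.
pose term P : K :=
  (part_coeff P)%:~R * [forall B in P, const_on z B]%:R * (zeros F z)%:R.
have allP : \sum_(P in set_partitions t) term P = 0.
  rewrite -mulr_suml.
  rewrite (_ : \sum_(P in _) _ = (dinjectiveb z (mem [set: 'I_t]))%:R).
    rewrite -natrM mulnb; case: dinjectiveP => // injz.
    case: (boolP (zeros F z)) => // Fz; case: noz; split=> // i j.
    by apply: injz; rewrite inE.
  transitivity ((\sum_(P | partition P [set: 'I_t])
                 \prod_(B in P) block_weight z B)%:~R : K).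
    rewrite rmorph_sum; apply: eq_big => [P | P]; first by rewrite inE.
    by rewrite inE => PT; rewrite -part_coeff_const_on // rmorphM /= rmorph_nat.
  by rewrite sum_partitions_injective rmorph_nat.
have oneP : one_block t \in set_partitions t.
  rewrite inE /partition /one_block /cover big_set1 eqxx trivIset1.
  by rewrite inE eq_sym.
have term1 : term (one_block t) =
    ((-1) ^+ t.-1 * (t.-1)`!%:R)%:~R * (const_on z [set: 'I_t])%:R.
  rewrite /term /part_coeff /one_block big_set1 cards1 cardsT card_ord subn1.
  rewrite -[LHS]mulrA -natrM mulnb; congr (_ * _%:R).
  have -> : [forall B in [set [set: 'I_t]], const_on z B] = const_on z [set: 'I_t].
    by apply/forall_inP/idP => [|cz B]; [apply; rewrite inE | rewrite inE => /eqP->].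
  case cz: (const_on z _) => //=.
  by rewrite (zeros_const_on FX (zX j0)).
have termR P : P \in R ->
    term P = (part_coeff P)%:~R * (const_on z [set: 'I_t])%:R.
  move=> PR; have := subsetP sR P PR; rewrite !inE => /andP[_ PT].
  rewrite /term -mulrA -natrM mulnb; congr (_ * _%:R).
  congr nat_of_bool; apply/andP/idP => [[/forall_inP cP Fz] | cz].
    exact: (zeros_singular (singR P PR) PT cP zX Fz).
  split; last exact: zeros_const_on (zX j0) cz.
  apply/forall_inP => B _; apply/const_onP => i j _ _.
  by have /const_onP cz' := cz; apply: cz'; rewrite inE.
move: allP; rewrite (big_setD1 _ oneP) /= (big_setID R) /= (setIidPr sR).
rewrite setDDl [[set _] :|: R]setUC => /eqP.
rewrite addrA addrC addr_eq0 => /eqP ->.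
rewrite term1 (eq_bigr _ termR) -mulr_suml -mulrDl -mulNr; congr (_ * _).
rewrite /beta rmorphB rmorph_sum /= opprD; congr (_ - _).
by rewrite -rmorphN -mulNr -mulN1r -exprS prednK.
Qed.

(** * The bounds for sets and sequences *)

Lemma size_le_mult_card (T : finType) (S : seq T) (m : nat) :
  (forall a, (#|[set i : 'I_(size S) | tnth (in_tuple S) i == a]| <= m)%N) ->
  (size S <= m * #|[set a in S]|)%N.
Proof.
move=> multS; have -> : size S = (\sum_(i < size S) 1)%N.
  by rewrite sum1_card card_ord.
rewrite (partition_big (tnth (in_tuple S)) (mem [set a in S])) /=; last first.
  by move=> i _; rewrite inE; apply: mem_tnth.
rewrite mulnC -sum_nat_const; apply: leq_sum => a _.
by apply: leq_trans (multS a); rewrite -sum1dep_card.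
Qed.

Lemma vanishesP (K : finFieldType) (t n : nat) (F : {mpoly K[t]})
    (z : 'I_t -> 'rV[K]_n) : reflect (vanishes F z) (zeros F z).
Proof. exact: 'forall_eqP. Qed.

Lemma const_on_inj (T : finType) (Y Y' : eqType) (e : Y -> Y') (z : T -> Y)
    (B : {set T}) : injective e -> const_on (fun j => e (z j)) B = const_on z B.
Proof.
move=> inje; apply/const_onP/const_onP => cB i j iB jB.
  exact/inje/cB.
by rewrite (cB i j).
Qed.

Theorem proposition4p5 (K : finFieldType) (X : {set K}) (t n : nat)
    (ht : (2 <= t)%N) (hn : (1 <= n)%N) (F : {mpoly K[t]})
    (hF : forall a : K, a \in X -> F.@[fun _ => a] = 0)
    (R : {set {set {set 'I_t}}})
    (hR : R \subset set_partitions t :\ one_block t)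
    (hRF : forall P : {set {set 'I_t}}, P \in R ->
       forall y : 'I_#|P| -> K, (forall i, y i \in X) ->
         contraction F y = 0 -> forall i j, y i = y j)
    (hbeta : (beta R)%:~R != 0 :> K) :
  (forall A : {set 'rV[K]_n}, A \subset cube X n ->
     ~ (exists z : 'I_t -> 'rV[K]_n,
          [/\ injective z, forall j, z j \in A & vanishes F z]) ->
     (#|A| <= \sum_(P in set_partitions t :\: (R :|: [set one_block t]))
                 slice_rank (restricted_zero_tensor F P X n))%N)
  /\
  (forall S : seq 'rV[K]_n, {subset S <= cube X n} ->
     ~ (exists u : 'I_t -> 'I_(size S),
          injective u /\ vanishes F (fun j => tnth (in_tuple S) (u j))) ->
     (size S <= t.-1 *
        \sum_(P in set_partitions t :\: (R :|: [set one_block t]))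
           slice_rank (restricted_zero_tensor F P X n))%N).

Proof.
have t0 : (0 < t)%N := ltnW ht; pose j0 := Ordinal t0.
set O := set_partitions t :\: _.
have boundA (A : {set 'rV[K]_n}) : A \subset cube X n ->
    ~ (exists z : 'I_t -> 'rV[K]_n,
         [/\ injective z, forall j, z j \in A & vanishes F z]) ->
    (#|A| <= \sum_(P in O) slice_rank (restricted_zero_tensor F P X n))%N.
  move=> sAX noA; pose Y := {v : 'rV[K]_n | v \in A}.
  pose e (a : Y) : {v | v \in cube X n} :=
    exist _ (val a) (subsetP sAX _ (valP a)).
  pose rk P := slice_rank (restricted_zero_tensor F P X n).
  have slices P : exists S : 'I_(rk P) -> ('I_t -> Y) -> K, P \in O ->
      (forall k, reducible [set: 'I_t] (S k)) /\
      forall z, (part_coeff P)%:~R * [forall B in P, const_on z B]%:R *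
        (zeros F (fun j => val (z j)))%:R = \sum_k S k z.
    have [PO | _] := boolP (P \in O); last by exists (fun _ _ => 0).
    move: (PO); rewrite !inE negb_or => /andP[/andP[_ Pn1] PT].
    have [rep repP] := partition_rep j0 PT.
    have Pn0 : P != set0.
      apply/eqP => P0; have : j0 \in cover P by rewrite (cover_partition PT) inE.
      by rewrite P0 /cover big_set0 inE.
    have [S [redS sumS]] := slice_rank_reducible e (part_coeff P)%:~R
      (restricted_zero_tensor F P X n) PT Pn1 Pn0 repP.
    exists S => _; split=> // z; rewrite -sumS.
    case: forall_inP => [cP | _]; last by rewrite !mulr0 !mul0r.
    congr (_ * _); rewrite ffunE -(zero_tensor_const_on _ PT repP).
      rewrite /zero_tensor; apply: eq_bigr => h _; congr (1 - _ ^+ _).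
      apply: meval_eq => j; rewrite /block_pullback.
      by case: pickP => // i _; rewrite ffunE.
    by move=> B /cP; rewrite (const_on_inj _ _ val_inj).
  have /fin_all_exists[S redS] := slices.
  (* One index for each slice of each of the tensors T_{F,P}. *)
  pose Q := [set p : {P : {set {set 'I_t}} & 'I_(rk P)} | tag p \in O].
  have cardQ : #|Q| = (\sum_(P in O) rk P)%N.
    transitivity (\sum_(P in O) \sum_(k < rk P) 1)%N.
      rewrite sig_big_dep /= sum1dep_card; apply: eq_card => p.
      by rewrite !inE andbT.
    by apply: eq_bigr => P _; rewrite sum1_card card_ord.
  rewrite -cardQ -[#|A|]card_sig.
  have <- : #|[set a : Y | (beta R)%:~R != 0 :> K]| = #|{: Y}|.
    by apply: eq_card => a; rewrite !inE hbeta.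
  apply: (@diagonal_partition_rank _ _ _ _ [set: 'I_t] Q
            (fun p => S (tag p) (tagged p)) (fun=> (beta R)%:~R)).
  - by apply/set0Pn; exists j0; rewrite inE.
  - by move=> [P k]; rewrite inE /= => PO; have [] := redS P PO.
  move=> z; transitivity (\sum_(P in O) \sum_k S P k z).
    rewrite sig_big_dep /=; apply: eq_bigl => p.
    by rewrite inE andbT.
  under eq_bigr => P PO do rewrite -(redS P PO).2.
  under eq_bigr => P PO.
    rewrite (_ : [forall B in P, const_on z B] =
                 [forall B in P, const_on (fun j => val (z j)) B]); last first.
      by apply: eq_forallb_in => B _; rewrite (const_on_inj _ _ val_inj).
    over.
  rewrite (diagonal_identity (X := X)) //; last first.
  - move=> [injz Fz]; case: noA; exists (fun j => val (z j)); split=> //.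
      by move=> j; apply: valP.
    exact/vanishesP.
  - by move=> j; apply: (subsetP sAX); apply: valP.
  rewrite -mulr_sumr; congr (_ * _).
  rewrite (const_on_inj _ _ val_inj).
  case: const_onP => [cz | ncz].
    rewrite (bigD1 (z j0)) //= [X in _ + X]big1 => [|a ane].
      by rewrite addr0 big1 // => j _; rewrite (cz j j0) ?inE // eqxx.
    by rewrite (bigD1 j0) ?inE //= eq_sym (negPf ane) mul0r.
  rewrite mulr0n big1 // => a _; apply/eqP/prodf_eq0.
  apply/exists_inP; apply: contra_notT ncz => /exists_inPn nza i j _ _.
  have za k : z k = a.
    by have := nza k; rewrite inE; case: (z k =P a) => // _ /(_ isT); rewrite eqxx.
  by rewrite !za.
split=> // S SX noS.
apply: leq_trans (size_le_mult_card (m := t.-1) _) _ => [a|].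
  rewrite leqNgt; apply/negP; rewrite (prednK t0) => lett.
  (* The first t indices at which S takes the value a. *)
  case: noS; exists (fun j => enum_val (widen_ord lett j)); split.
    by move=> i j /enum_val_inj/(congr1 val)/= /val_inj.
  apply/vanishesP/(zeros_const_on (j := j0) hF) => /=.
    exact/SX/mem_tnth.
  apply/const_onP => i j _ _.
  have eqa k : tnth (in_tuple S) (enum_val (widen_ord lett k)) = a.
    by have := enum_valP (widen_ord lett k); rewrite inE => /eqP.
  by rewrite !eqa.
rewrite leq_mul2l; apply/orP; right; apply: boundA.
  by apply/subsetP => a; rewrite inE => /SX.
move=> [z [injz zS Fz]]; case: noS.
have /fin_all_exists[u uz] j : exists u : 'I_(size S), tnth (in_tuple S) u = z j.
  have := zS j; rewrite inE => zSj.
  by have /tnthP[u] : z j \in in_tuple S by []; exists u.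
exists u; split=> [i j uij | h].
  by apply: injz; rewrite -!uz uij.
by rewrite -(Fz h); apply: meval_eq => j; rewrite uz.
Qed.
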